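(* Let $\epsilon=\epsilon(n)$ be a real-valued function of $n$ with $\epsilon(n)<1/2$ such that $n^{1-\epsilon}\ll n$, and let $m=m(n)=(1-2\epsilon)\lg n$ (assumed to be a positive integer with $m\le n$ for all sufficiently large $n$). Let $\mathcal{F}_m=(F_{m,1},\ldots,F_{m,n},\ldots)$ be the graph sequence whose $n$-th term is the fuse graph $F_{m(n),n}$ on $n$ vertices. Then $\tau(\mathcal{F}_m)=\Theta(n^{1-\epsilon})$, that is, the set of threshold functions of $\mathcal{F}_m$ is exactly the class $\Theta(n^{1-\epsilon})$.
   Context: Fuse graph: for integers $1\le m\le n$, $F_{m,n}$ is the graph with vertex set $\{v_1,\ldots,v_n\}=W\cup S$, where $W=\{v_1,\ldots,v_m\}$ and $S=\{v_{m+1},\ldots,v_n\}$, and with edges $\{v_i,v_{i+1}\}$ for $i=1,\ldots,m-1$ and $\{v_i,v_m\}$ for $i=m+1,\ldots,n$ (a path on $m$ vertices with the remaining $n-m$ vertices attached as leaves to its endpoint $v_m$). When $m$ is a function of $n$, $F_{m,n}$ means $F_{m(n),n}$; the finitely many small $n$ for which it is not defined are irrelevant to the asymptotic statement. Pebbling: let $G=(V,E)$ be a connected graph on $n$ vertices. A configuration $C$ of $t$ pebbles on $G$ is a multiset of $t$ elements of $V$; $C(v)$ denotes the number of pebbles on $v$. A pebbling step removes two pebbles from a vertex $v$ and places one pebble on a neighbor of $v$. $C$ is $r$-solvable if at least one pebble can be placed on the vertex $r$ by a (possibly empty) sequence of pebbling steps, and solvable if it is $r$-solvable for every $r\in V$.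 A random configuration of $t$ pebbles is chosen uniformly from all $\binom{n+t-1}{t}$ configurations (multisets). Threshold: for a graph sequence $\mathcal{G}=(G_1,\ldots,G_n,\ldots)$, where $G_n$ has $n$ vertices, a function $t=t(n)$ is a threshold of $\mathcal{G}$ if, as $n\to\infty$: (1) for every $t_1\ll t$ the probability that a random configuration of $t_1$ pebbles on $G_n$ is solvable tends to $0$; and (2) for every $t_2\gg t$ the probability that a random configuration of $t_2$ pebbles on $G_n$ is solvable tends to $1$. $\tau(\mathcal{G})$ denotes the set of all threshold functions of $\mathcal{G}$. Numbers of pebbles are integers. Notation: $f\ll g$ (equivalently $g\gg f$) means $f(n)/g(n)\to0$ as $n\to\infty$; $f\in O(g)$ (resp. $f\in\Omega(g)$) means there are positive constants $c,k$ with $f(n)<c\,g(n)$ (resp. $f(n)>c\,g(n)$) for all $n>k$; $\Theta(g)=O(g)\cap\Omega(g)$; $\lg$ is the base-2 logarithm. *)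

(* Defs.v *)
From mathcomp Require Import all_boot all_order all_algebra.
From mathcomp Require Import all_classical all_reals all_analysis.
From Stdlib Require Import Relation_Operators.

Set Implicit Arguments.
Unset Strict Implicit.
Unset Printing Implicit Defensive.

Import Order.TTheory GRing.Theory Num.Theory.
Import numFieldNormedType.Exports.

Local Open Scope ring_scope.

(* The vertex v_(i+1) is the element i of 'I_n.  [a -> b] is a path edge if
   b = a + 1 lies in W, and a leaf edge if a is the last vertex of W (index
   m - 1) and b lies in S (index at least m). *)
Definition fuse_arc (m a b : nat) : bool :=
  ((a.+1 == b) && (b < m) || (a.+1 == m) && (m <= b))%N.

Definition fuse_graph (m n : nat) : rel 'I_n :=
  fun a b => fuse_arc m a b || fuse_arc m b a.

Lemma fuse_graph_sym m n : symmetric (@fuse_graph m n).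
Proof. by move=> a b; rewrite /fuse_graph orbC. Qed.

Lemma fuse_graph_irr m n : irreflexive (@fuse_graph m n).
Proof.
move=> a; rewrite /fuse_graph orbb /fuse_arc (gtn_eqF (ltnSn a)) /=.
by case: eqP => //= <-; rewrite ltnn.
Qed.

Lemma fuse_graph_connected m n : (0 < m <= n)%N ->
  forall a b : 'I_n, connect (@fuse_graph m n) a b.
Proof.
move=> /andP[m0 mn].
have n0 : (0 < n)%N by exact: leq_trans mn.
pose z : 'I_n := Ordinal n0.
have csym : connect_sym (@fuse_graph m n).
  exact/sym_connect_sym/fuse_graph_sym.
have W k (kn : (k < n)%N) : (k < m)%N ->
    connect (@fuse_graph m n) z (Ordinal kn).
  elim: k kn => [|k IH] kn km.
    by rewrite (_ : Ordinal kn = z) ?connect0 //; exact: val_inj.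
  apply: connect_trans (IH (ltnW kn) (ltnW km)) (connect1 _).
  by rewrite /fuse_graph /fuse_arc /= eqxx km.
suff Z a : connect (@fuse_graph m n) z a.
  by move=> a b; apply: connect_trans (Z b); rewrite csym.
case: a => k kn; case: (ltnP k m) => [/W//|mk].
have pn : (m.-1 < n)%N by rewrite prednK.
apply: connect_trans (W _ pn _) (connect1 _); first by rewrite prednK.
by rewrite /fuse_graph /fuse_arc /= prednK // eqxx mk orbT.
Qed.

Section Pebbling.
Variables (V : finType) (E : rel V).

Definition pebbling_step (C D : {ffun V -> nat}) : Prop :=
  exists u v : V, [/\ E u v, (2 <= C u)%N &
    D = [ffun w => C w - (w == u).*2 + (w == v)]%N].

Definition solvable_at (r : V) (C : {ffun V -> nat}) : Prop :=
  exists2 D, clos_refl_trans _ pebbling_step C D & (0 < D r)%N.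

Definition pebble_solvable (C : {ffun V -> nat}) : Prop :=
  forall r : V, solvable_at r C.

End Pebbling.

(* A multiset of t vertices, given by its multiplicities; these are at most t,
   whence the finite codomain. *)
Definition configs (V : finType) (t : nat) : {set {ffun V -> 'I_t.+1}} :=
  [set C : {ffun V -> 'I_t.+1} | (\sum_v C v == t)%N].

Lemma card_configs (V : finType) t : (0 < #|V|)%N ->
  #|configs V t| = 'C(#|V| + t - 1, t).
Proof.
case vE : #|V| => [//|k] _.
rewrite addSn subn1 -bin_sub ?leq_addl //= addnK.
rewrite -card_ord_partitions.
pose f (s : k.+1.-tuple 'I_t.+1) : {ffun V -> 'I_t.+1} :=
  [ffun v => tnth s (cast_ord vE (enum_rank v))].
pose g (C : {ffun V -> 'I_t.+1}) : k.+1.-tuple 'I_t.+1 :=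
  [tuple C (enum_val (cast_ord (esym vE) i)) | i < k.+1].
have gK : cancel g f.
  by move=> C; apply/ffunP => v; rewrite ffunE tnth_mktuple cast_ordK enum_rankK.
have fK : cancel f g.
  move=> s; apply: eq_from_tnth => i.
  by rewrite tnth_mktuple ffunE enum_valK cast_ordKV.
rewrite -(card_imset _ (can_inj gK)); apply: eq_card => s.
rewrite -[s]fK mem_imset ?inE; last exact: can_inj gK.
rewrite fK big_tuple; congr (_ == _).
rewrite (reindex (fun i => enum_val (cast_ord (esym vE) i))) /=.
  by apply: eq_bigr => i _; rewrite ffunE enum_valK cast_ordKV.
exists (fun v => cast_ord vE (enum_rank v)) => [i _|v _].
  by rewrite enum_valK cast_ordKV.
by rewrite cast_ordK enum_rankK.
Qed.

Definition solvable_prob (R : realType) (V : finType) (E : rel V) (t : nat) : R :=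
  #|[set C in configs V t |
      `[< pebble_solvable E [ffun v => C v : nat] >]]|%:R / #|configs V t|%:R.

Section Asymptotics.
Local Open Scope classical_set_scope.
Variable R : realType.
Implicit Types f g t : nat -> R.

(* f(n)/g(n) -> 0, the quotient being defined for all large n: as x / 0 = 0
   here, the limit alone would make every f negligible with respect to 0. *)
Definition negligible_wrt f g : Prop :=
  (\forall n \near \oo, g n != 0) /\ f n / g n @[n --> \oo] --> (0 : R).

Definition bigO_of g : set (nat -> R) :=
  [set f | exists c k : R, [/\ 0 < c, 0 < k &
    forall n : nat, k < n%:R -> f n < c * g n]].

Definition bigOmega_of g : set (nat -> R) :=
  [set f | exists c k : R, [/\ 0 < c, 0 < k &
    forall n : nat, k < n%:R -> f n > c * g n]].

Definition bigTheta_of g : set (nat -> R) :=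
  bigO_of g `&` bigOmega_of g.

(* Numbers of pebbles are natural numbers, whereas thresholds may be real
   valued.  Being compared with numbers of pebbles, a threshold has to be
   nonnegative for large n: the relation f << g ignores the sign of g, so that
   otherwise the opposite of a threshold would be one too. *)
Definition is_threshold (G : forall n, rel 'I_n) t : Prop :=
  [/\ \forall n \near \oo, 0 <= t n,
      forall t1 : nat -> nat,
        negligible_wrt (fun n => (t1 n)%:R) t ->
        solvable_prob R (G n) (t1 n) @[n --> \oo] --> (0 : R) &
      forall t2 : nat -> nat,
        negligible_wrt t (fun n => (t2 n)%:R) ->
        solvable_prob R (G n) (t2 n) @[n --> \oo] --> (1 : R)].

Definition threshold_set (G : forall n, rel 'I_n) : set (nat -> R) :=
  [set t | is_threshold G t].

Definition lg (x : R) : R := ln x / ln 2.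

End Asymptotics.

(* Main.v *)
Require Import Defs.
From mathcomp Require Import all_boot all_order all_algebra.
From mathcomp Require Import all_classical all_reals all_analysis.
From mathcomp Require Import zify ring lra.
From Stdlib Require Import Relation_Operators.

(** Put [T = n ^ (1 - eps)].  The definition of [m] says that [2 ^ m] is
    [n ^ (1 - 2 eps)], that is, [T ^ 2 = n * 2 ^ m]; and [T << n] says that
    [2 ^ m << n].  So nearly all the vertices are leaves, and the vertex which is
    hardest to reach is the far end [v_1] of the path: it takes [2 ^ (m - 1)]
    pebbles at the centre [v_m], and a leaf supplies one for each pair of
    pebbles that it holds.  For [t <= n] random pebbles a leaf holds a pair with
    probability about [(t / n) ^ 2], whence about [t ^ 2 / n] pairs: these are
    enough when [t ^ 2 / n] is much larger than [2 ^ m], that is when [t >> T],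
    and not when [t << T].

    Upper bound on the probability of solvability: the potential
    [fuse_potential], a weighted number of pebbles on the path and of pairs on
    the leaves, never increases ([fuse_potential_step]) and has to be at least
    [2 ^ (m - 1)] for [v_1] to be reachable.  Its mean is at most
    [2 ^ m * (t / n) + t ^ 2 / n], and Markov's inequality gives
    [solvable_prob_le].

    Lower bound: [2 ^ m] heavy leaves, that is leaves with at least two pebbles,
    suffice ([fuse_solvable]).  The events that given leaves are heavy are
    negatively correlated, so that Chebyshev's inequality bounds the probability
    of having less than half of the expected number of them
    ([solvable_prob_ge]).

    The moments come from a bijection which removes pebbles from a vertex
    ([sum_configs_shift]) and the recurrence for the number of configurations.
    Both bounds are uniform in [t], and [threshold_criterion] turns them into
    the determination of all thresholds. *)

Set Implicit Arguments.
Unset Strict Implicit.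
Unset Printing Implicit Defensive.

Import Order.TTheory GRing.Theory Num.Theory.
Import numFieldNormedType.Exports.

Local Open Scope ring_scope.

(** * Moving pebbles on fuse graphs *)

Lemma solvable_at_trans (V : finType) (E : rel V) (r : V) (C D : {ffun V -> nat}) :
  clos_refl_trans _ (pebbling_step E) C D -> solvable_at E r D ->
  solvable_at E r C.
Proof. by move=> CD [D' DD' rD']; exists D' => //; apply: rt_trans CD DD'. Qed.

Lemma push_pebbles (V : finType) (E : rel V) (irr : irreflexive E)
    (u v : V) (k : nat) (C : {ffun V -> nat}) :
  E u v -> (k.*2 <= C u)%N ->
  exists2 D, clos_refl_trans _ (pebbling_step E) C D & (C v + k <= D v)%N.
Proof.
move=> Euv; have vu : (v == u) = false.
  by apply: contraTF Euv => /eqP ->; rewrite irr.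
elim: k C => [|k IH] C Cu; first by exists C; [exact: rt_refl|rewrite addn0].
pose C1 := [ffun w => C w - (w == u).*2 + (w == v)]%N.
have [|D C1D vD] := IH C1; first by rewrite ffunE eqxx eq_sym vu /=; lia.
exists D; last by move: vD; rewrite ffunE eqxx vu /=; lia.
apply: rt_trans C1D; apply: rt_step; exists u, v; split => //; lia.
Qed.

(** The vertices of [A] give away pebbles one after the other: the loss of one
    of them leaves the others heavy, and [c] itself is not in [A] as [E] has no
    loop. *)
Lemma gather_pebbles (V : finType) (E : rel V) (irr : irreflexive E)
    (c : V) (A : {set V}) (C : {ffun V -> nat}) :
  (forall a, a \in A -> E a c /\ (2 <= C a)%N) ->
  exists2 D, clos_refl_trans _ (pebbling_step E) C D & (#|A| <= D c)%N.
Proof.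
suff: (forall a, a \in A -> E a c /\ (2 <= C a)%N) ->
  exists2 D, clos_refl_trans _ (pebbling_step E) C D & (C c + #|A| <= D c)%N.
  by move=> H /H[D CD cD]; exists D => //; apply: leq_trans cD; exact: leq_addl.
move k_def : #|A| => k.
elim: k A C k_def => [|k IH] A C Ak HA.
  by exists C; [exact: rt_refl|rewrite addn0].
have /card_gt0P[a aA] : (0 < #|A|)%N by rewrite Ak.
have [Eac Ca] := HA a aA.
have ca : (c == a) = false by apply: contraTF Eac => /eqP ->; rewrite irr.
pose C1 := [ffun w => C w - (w == a).*2 + (w == c)]%N.
have [||D C1D cD] := IH (A :\ a) C1.
- by move: Ak; rewrite (cardsD1 a) aA; lia.
- move=> b /setD1P[ba bA]; have [Ebc Cb] := HA b bA; split => //.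
  by rewrite ffunE (negPf ba) /=; lia.
exists D; last by move: cD; rewrite ffunE eqxx ca /=; lia.
by apply: rt_trans C1D; apply: rt_step; exists a, c.
Qed.

(** Each edge walked along the path halves the number of pebbles. *)
Lemma solvable_path_vertex (m n : nat) (C : {ffun 'I_n -> nat}) (d : nat) (r b : 'I_n) :
  (b < m)%N -> (b = r + d :> nat)%N -> (2 ^ d <= C b)%N ->
  solvable_at (@fuse_graph m n) r C.
Proof.
elim: d C b => [|d IH] C b bm; rewrite ?addn0 => bE Cb.
  by exists C; [exact: rt_refl|rewrite (_ : r = b) //; exact/val_inj].
have an : (r + d < n)%N by have := ltn_ord b; lia.
have [||D CD aD] := push_pebbles (@fuse_graph_irr m n) (u := b) (v := Ordinal an)
    (k := (2 ^ d)%N) (C := C).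
- by rewrite /fuse_graph /fuse_arc /= bE addnS eqxx /= -addnS -bE bm orbT.
- by rewrite -mul2n -expnS.
apply: solvable_at_trans CD (IH D (Ordinal an) _ _ _) => //=; first lia.
exact: leq_trans (leq_addl _ _) aD.
Qed.

(** Every heavy leaf sends one pebble to the centre [v_m], and [2 ^ m] pebbles
    there are enough for every vertex: the far end of the path is at distance
    [m - 1], and a leaf at distance 1. *)
Lemma fuse_solvable (m n : nat) (C : {ffun 'I_n -> nat}) :
  (0 < m <= n)%N ->
  (2 ^ m <= #|[set a : 'I_n | (m <= a)%N && (2 <= C a)%N]|)%N ->
  pebble_solvable (@fuse_graph m n) C.
Proof.
move=> /andP[m0 mn] CA r.
have cn : (m.-1 < n)%N by rewrite prednK.
pose c := Ordinal cn.
have leafE (a : 'I_n) : (m <= a)%N -> fuse_graph m a c.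
  by move=> ma; rewrite /fuse_graph /fuse_arc /= prednK // eqxx ma !orbT.
have [a|D CD cD] := gather_pebbles (@fuse_graph_irr m n) (c := c) (C := C)
   (A := [set a : 'I_n | (m <= a)%N && (2 <= C a)%N]).
  by rewrite inE => /andP[/leafE].
apply: solvable_at_trans CD _; move: {CA cD}(leq_trans CA cD) => cD.
have [rm|mr] := ltnP r m.
  apply: (@solvable_path_vertex m n D (m.-1 - r) r c); rewrite /= ?subnKC //; try lia.
  by apply: leq_trans cD; rewrite leq_exp2l //; lia.
have [||D' DD' rD'] := push_pebbles (@fuse_graph_irr m n) (u := c) (v := r)
    (k := 1) (C := D).
- by rewrite fuse_graph_sym leafE.
- by apply: leq_trans cD; rewrite (leq_exp2l 1).
by exists D' => //; lia.
Qed.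

(** [2 ^ (m - 1)] times an upper bound for the number of pebbles that [C] can
    bring to the far end [v_1].  A pebble at distance [i] of [v_1] on the path
    counts for [2 ^ - i]; a leaf sends at most half of its pebbles to the centre,
    so that only pairs of pebbles count there, whence the rounded division. *)
Definition fuse_potential (m n : nat) (C : {ffun 'I_n -> nat}) : nat :=
  (\sum_(v < n) if (v < m)%N then C v * 2 ^ (m.-1 - v) else C v %/ 2)%N.

(** A step towards [v_1] leaves the potential unchanged, a step away from it
    does not increase it: in particular the one pebble which a leaf receives
    from the centre completes at most one pair. *)
Lemma fuse_potential_step (m n : nat) (C D : {ffun 'I_n -> nat}) :
  pebbling_step (@fuse_graph m n) C D -> (fuse_potential m D <= fuse_potential m C)%N.
Proof.
case=> u [v [Euv Cu ->]].
have vu : v != u by apply: contraTN Euv => /eqP ->; rewrite fuse_graph_irr.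
(* Only the terms of the two ends of the move change. *)
rewrite /fuse_potential (bigD1 u) // [leqRHS](bigD1 u) //=.
rewrite (bigD1 v) // [in leqRHS](bigD1 v) //= !addnA; apply: leq_add; last first.
  by apply: leq_sum => w /andP[/negPf wu /negPf wv]; rewrite ffunE wu wv subn0 addn0.
rewrite !ffunE !eqxx (negPf vu) [u == v]eq_sym (negPf vu) /= subn0 addn0.
case: u v Euv Cu {vu} => [u un] [v vn]; rewrite /fuse_graph /fuse_arc /=.
set x := C _; set y := C _.
move=> /orP[|] /orP[] /andP[/eqP + uv] x2.
- move=> vE; rewrite uv (_ : (u < m)%N); last by lia.
  have -> : (m.-1 - u = (m.-1 - v).+1)%N by lia.
  by rewrite expnS; nia.
- move=> uE; rewrite [(v < m)%N]ltnNge uv -uE ltnSn /= subnn expn0; lia.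
- move=> uE; rewrite uv (_ : (v < m)%N); last by lia.
  have -> : (m.-1 - v = (m.-1 - u).+1)%N by lia.
  by rewrite expnS; nia.
- move=> vE; rewrite [(u < m)%N]ltnNge uv -vE ltnSn /= subnn expn0; lia.
Qed.

Lemma fuse_potential_solvable (m n : nat) (C : {ffun 'I_n -> nat}) :
  (0 < m <= n)%N -> pebble_solvable (@fuse_graph m n) C ->
  (2 ^ m.-1 <= fuse_potential m C)%N.
Proof.
move=> /andP[m0 mn] solC.
have n0 : (0 < n)%N by exact: leq_trans mn.
have {solC}[D CD D0] := solC (Ordinal n0).
have DC : (fuse_potential m D <= fuse_potential m C)%N.
  elim: CD => [C' D'|//|x y z _ yx _ zy]; first exact: fuse_potential_step.
  exact: leq_trans yx.
apply: leq_trans DC; rewrite /fuse_potential (bigD1 (Ordinal n0)) //= m0 subn0.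
by apply: leq_trans (leq_addr _ _); rewrite leq_pmull.
Qed.

(** * Moments of random configurations *)

(** The configuration given by [C], without the bound [t] which its codomain
    carries.  Different numbers of pebbles then share one type, as the shifts
    below require. *)
Definition mult (V : finType) (t : nat) (C : {ffun V -> 'I_t.+1}) :
  {ffun V -> nat} := [ffun v => C v : nat].

Definition add_pebbles (V : finType) (k : nat) (v : V) (C : {ffun V -> nat}) :
  {ffun V -> nat} := [ffun w => C w + k * (w == v)]%N.

(** Removing [k] pebbles from [v] is a bijection from the configurations of
    [k + t] pebbles with at least [k] pebbles on [v] to those of [t] pebbles.
    All the moments below are computed by recursion on [t] through this
    bijection. *)
Lemma sum_configs_shift (V : finType) (v : V) (k t : nat) (h : {ffun V -> nat} -> nat) :
  (\sum_(C in configs V (k + t) | k <= mult C v) h (mult C) =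
   \sum_(C in configs V t) h (add_pebbles k v (mult C)))%N.
Proof.
pose f (C : {ffun V -> 'I_t.+1}) : {ffun V -> 'I_(k + t).+1} :=
  [ffun w => inord (C w + k * (w == v))].
pose g (C : {ffun V -> 'I_(k + t).+1}) : {ffun V -> 'I_t.+1} :=
  [ffun w => inord (C w - k * (w == v))].
have fE C w : f C w = (C w + k * (w == v))%N :> nat.
  rewrite ffunE inordK // ltnS addnC leq_add // ?leq_ord //.
  by case: (_ == _); rewrite ?muln0 ?muln1.
have fK : cancel f g.
  by move=> C; apply/ffunP => w; rewrite ffunE fE addnK inord_val.
have gK C : (C \in configs V (k + t)) && (k <= mult C v)%N -> f (g C) = C.
  rewrite inE ffunE => /andP[/eqP Ct kv]; apply/ffunP => w; apply/val_inj.
  rewrite /= fE ffunE inordK.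
    by case: eqP => [->|_]; rewrite ?muln1 ?muln0 ?subnK ?subn0 ?addn0.
  have := Ct; rewrite (bigD1 v) //=; case: eqP => [->|/eqP wv].
    by rewrite muln1; lia.
  by rewrite (bigD1 w) //= muln0; lia.
rewrite (reindex_onto f g) => //.
apply: eq_big => [C|C _]; last first.
  by apply: (congr1 h); apply/ffunP => w; rewrite ffunE [RHS]ffunE fE ffunE.
rewrite fK eqxx andbT !inE ffunE fE eqxx muln1 leq_addl andbT.
under eq_bigr do rewrite fE.
rewrite big_split /= [X in (_ + X)%N](bigD1 v) //= eqxx muln1.
rewrite [X in (_ + (_ + X))%N]big1 ?addn0 ?[(k + t)%N]addnC ?eqn_add2r //.
  by move=> w /negPf ->; rewrite muln0.
Qed.

Lemma sum_configs_vanish (V : finType) (v : V) (k t : nat) (h : {ffun V -> nat} -> nat) :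
  (forall C : {ffun V -> nat}, (C v < k)%N -> h C = 0%N) ->
  (\sum_(C in configs V (k + t)) h (mult C) =
   \sum_(C in configs V t) h (add_pebbles k v (mult C)))%N.
Proof.
move=> h0; rewrite -sum_configs_shift (bigID (fun C => k <= mult C v)%N) /=.
rewrite [X in (_ + X)%N]big1 ?addn0 // => C /andP[_].
by rewrite -ltnNge => /h0.
Qed.

Lemma mult_le (V : finType) (v : V) (t : nat) (C : {ffun V -> 'I_t.+1}) :
  (mult C v <= t)%N.
Proof. by rewrite ffunE -ltnS. Qed.

Lemma add_pebbles_same (V : finType) (v : V) (k : nat) (C : {ffun V -> nat}) :
  add_pebbles k v C v = (C v + k)%N.
Proof. by rewrite ffunE eqxx muln1. Qed.

Lemma add_pebbles_other (V : finType) (u v : V) (k : nat) (C : {ffun V -> nat}) :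
  v != u -> add_pebbles k u C v = C v.
Proof. by move=> /negPf vu; rewrite ffunE vu muln0 addn0. Qed.

Lemma card_configsS (V : finType) (t : nat) : (0 < #|V|)%N ->
  (t.+1 * #|configs V t.+1| = (#|V| + t) * #|configs V t|)%N.
Proof.
move=> V0; rewrite !card_configs // -mul_bin_diag addnS subn1 /=.
by case: #|V| V0 => [//|n] _; rewrite addSn subn1.
Qed.

Lemma card_configs_gt0 (V : finType) (t : nat) : (0 < #|V|)%N -> (0 < #|configs V t|)%N.
Proof. by move=> V0; rewrite card_configs // bin_gt0; lia. Qed.

Lemma sum_mult (V : finType) (v : V) (t : nat) :
  (#|V| * \sum_(C in configs V t) mult C v = t * #|configs V t|)%N.
Proof.
have V0 : (0 < #|V|)%N by apply/card_gt0P; exists v.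
elim: t => [|t IH].
  rewrite big1 ?muln0 // => C _; apply/eqP; rewrite -leqn0; exact: mult_le.
rewrite (@sum_configs_vanish V v 1 t (fun C : {ffun V -> nat} => C v)); last first.
  by move=> C; case: (C v).
under eq_bigr do rewrite add_pebbles_same.
by rewrite big_split /= sum_nat_const muln1 mulnDr IH card_configsS // mulnDl addnC.
Qed.

(** The half of [C v] rounded down is at most the number [C v * (C v - 1) / 2]
    of pairs of pebbles on [v], of mean [t * (t - 1) / (#|V| * (#|V| + 1))].
    The induction proves this bound. *)
Lemma sum_half_mult (V : finType) (v : V) (t : nat) :
  (#|V| ^ 2 * \sum_(C in configs V t) mult C v %/ 2 <= t ^ 2 * #|configs V t|)%N.
Proof.
have V0 : (0 < #|V|)%N by apply/card_gt0P; exists v.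
suff H : (#|V| * #|V|.+1 * \sum_(C in configs V t) mult C v %/ 2 <=
     t * t.-1 * #|configs V t|)%N by nia.
have small (s : nat) : (s < 2)%N ->
    (\sum_(C in configs V s) mult C v %/ 2 = 0)%N.
  move=> s2; rewrite big1 // => C _; apply: divn_small.
  exact: leq_ltn_trans (mult_le v C) s2.
(* Removing a pair from [v] lowers the rounded half by 1: induction by steps of 2. *)
elim: t {-2}t (leqnn t) => [|u IH] [|[|t]] tu //; only 1-3: by rewrite small ?muln0.
have -> : (\sum_(C in configs V t.+2) mult C v %/ 2 =
    \sum_(C in configs V t) add_pebbles 2 v (mult C) v %/ 2)%N.
  apply: (@sum_configs_vanish V v 2 t (fun C : {ffun V -> nat} => C v %/ 2)%N) => C.
  exact: divn_small.
under eq_bigr do rewrite add_pebbles_same divnDr // divnn.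
rewrite big_split /= sum_nat_const muln1.
have /IH : (t <= u)%N by lia.
have := card_configsS t V0; have := card_configsS t.+1 V0.
set N := #|configs V t|; set N1 := #|configs V t.+1|; set N2 := #|configs V t.+2|.
set F := (\sum_(_ in _) _)%N.
move: #|V| N N1 N2 F => n N N1 N2 F e1 e2 HF.
have e3 : (t.+2 * t.+1 * N2 = (n + t.+1) * (n + t) * N)%N by nia.
by rewrite /= e3; case: t {tu IH e1 e2 e3} HF => [|t] /= HF; nia.
Qed.

Lemma sum_two_pebbles (V : finType) (v : V) (t : nat) :
  (\sum_(C in configs V t.+2) (2 <= mult C v) = #|configs V t|)%N.
Proof.
rewrite -sum1_card.
rewrite [LHS](@sum_configs_vanish V v 2 t (fun C : {ffun V -> nat} => (2 <= C v : nat)%N)).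
  by apply: eq_bigr => C _; rewrite add_pebbles_same addnC.
by move=> C; rewrite ltnNge; case: (2 <= C v)%N.
Qed.

(** The ratio of consecutive numbers of configurations is
    [(#|V| + t) / (t + 1)], which decreases with [t]. *)
Lemma card_configs_log_concave (V : finType) (t : nat) : (0 < #|V|)%N ->
  (#|configs V t| * #|configs V t.+4| <= #|configs V t.+2| ^ 2)%N.
Proof.
move=> V0.
have := card_configsS t V0; have := card_configsS t.+1 V0.
have := card_configsS t.+2 V0; have := card_configsS t.+3 V0.
move: #|configs V t| #|configs V t.+1| #|configs V t.+2| #|configs V t.+3|
  #|configs V t.+4| => a b c d e.
case: #|V| V0 => // n _ H4 H3 H2 H1.
have e1 : (t.+4 * t.+3 * e = (n + t.+4) * (n + t.+3) * c)%N by nia.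
have e2 : (t.+2 * t.+1 * c = (n + t.+2) * (n + t.+1) * a)%N by nia.
have le : ((n + t.+4) * (n + t.+3) * (t.+2 * t.+1) <= (n + t.+2) * (n + t.+1) * (t.+4 * t.+3))%N.
  by rewrite mulnACA [leqRHS]mulnACA leq_mul //; nia.
have p : (0 < t.+4 * t.+3 * (t.+2 * t.+1))%N by [].
rewrite -(leq_pmul2l p).
have -> : (t.+4 * t.+3 * (t.+2 * t.+1) * (a * e) = (n + t.+4) * (n + t.+3) * (t.+2 * t.+1) * (a * c))%N.
  by transitivity (t.+4 * t.+3 * e * (t.+2 * t.+1) * a)%N; [ring|rewrite e1; ring].
have -> : (t.+4 * t.+3 * (t.+2 * t.+1) * c ^ 2 = (n + t.+2) * (n + t.+1) * (t.+4 * t.+3) * (a * c))%N.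
  by transitivity (t.+2 * t.+1 * c * (t.+4 * t.+3) * c)%N; [ring|rewrite e2; ring].
by rewrite leq_mul2r le orbT.
Qed.

(** The events that [u], respectively [v], holds two pebbles are negatively
    correlated: divide both sides by the square of the number of configurations
    to read it as an inequality of probabilities. *)
Lemma sum_two_pebbles2 (V : finType) (u v : V) (t : nat) : u != v ->
  ((\sum_(C in configs V t.+2) (2 <= mult C u) * (2 <= mult C v)) * #|configs V t.+2|
    <= #|configs V t| ^ 2)%N.
Proof.
move=> uv; have V0 : (0 < #|V|)%N by apply/card_gt0P; exists v.
have -> : (\sum_(C in configs V t.+2) (2 <= mult C u) * (2 <= mult C v) =
    \sum_(C in configs V t) (2 <= add_pebbles 2 u (mult C) u) *
                             (2 <= add_pebbles 2 u (mult C) v))%N.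
  apply: (@sum_configs_vanish V u 2 t
    (fun C : {ffun V -> nat} => (2 <= C u) * (2 <= C v))%N) => C.
  by rewrite ltnNge; case: (2 <= C u)%N.
under eq_bigr do rewrite add_pebbles_same add_pebbles_other 1?eq_sym //.
case: t => [|[|t]].
- by rewrite big1 // => C _; have := mult_le v C; lia.
- by rewrite big1 // => C _; have := mult_le v C; lia.
apply: leq_trans (card_configs_log_concave t V0).
rewrite leq_mul2r -(sum_two_pebbles v t) leq_sum ?orbT // => C _.
by rewrite addn2 mul1n.
Qed.

(** * Probability of solvability on fuse graphs *)

(** On the path the weights [2 ^ (m - 1 - i)] add up to less than [2 ^ m], and
    each vertex has [t / n] pebbles on average; each of the at most [n] leaves
    contributes at most [(t / n) ^ 2] on average. *)
Lemma sum_fuse_potential (m n t : nat) : (0 < m <= n)%N ->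
  (n * \sum_(C in configs 'I_n t) fuse_potential m (mult C) <=
   (2 ^ m * t + t ^ 2) * #|configs 'I_n t|)%N.
Proof.
move=> /andP[m0 mn]; have n0 : (0 < n)%N by exact: leq_trans mn.
rewrite -(leq_pmul2l n0) mulnA mulnn /fuse_potential exchange_big /= big_distrr /=.
set N := #|_|.
have term (v : 'I_n) : (n ^ 2 * \sum_(C in configs 'I_n t)
      (if (v < m)%N then mult C v * 2 ^ (m.-1 - v) else mult C v %/ 2) <=
    (if (v < m)%N then n * (2 ^ (m.-1 - v) * t * N) else 0) + t ^ 2 * N)%N.
  have := sum_mult v t; have := sum_half_mult v t; rewrite card_ord -/N => h1 h2.
  case: ltnP => vm; last by rewrite add0n.
  apply: leq_trans (leq_addr _ _).
  by rewrite -big_distrl /= -mulnn -mulnA leq_mul2l mulnA h2 -[leqRHS]mulnA [leqRHS]mulnC leqnn orbT.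
apply: leq_trans (leq_sum _ (fun v _ => term v)) _.
rewrite big_split /= sum_nat_const card_ord -big_mkcond /= !mulnDl mulnDr leq_add2r.
rewrite -(big_ord_widen n (fun v => n * (2 ^ (m.-1 - v) * t * N))%N mn).
rewrite -big_distrr /= leq_mul2l; apply/orP; right.
under eq_bigr do rewrite -mulnA.
rewrite -big_distrl /= -mulnA leq_mul2r; apply/orP; right.
apply: leq_trans (leq_pred _); rewrite predn_exp mul1n leq_eqVlt; apply/orP; left.
rewrite [X in _ == X](reindex_inj rev_ord_inj); apply/eqP; apply: eq_bigr => i _ /=.
by congr (2 ^ _)%N; lia.
Qed.

(** Markov's inequality for the potential, which is at least [2 ^ (m - 1)] on
    solvable configurations. *)
Lemma solvable_prob_le (R : realType) (m n t : nat) : (0 < m <= n)%N ->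
  solvable_prob R (@fuse_graph m n) t <=
  2 * (t%:R / n%:R) + 2 * (t%:R ^+ 2 / (n%:R * 2 ^+ m)).
Proof.
move=> mn; have /andP[m0 mn'] := mn; have n0 : (0 < n)%N by exact: leq_trans mn'.
rewrite /solvable_prob; set S := finset _; set N := #|configs _ _|.
have N0 : (0 < N)%N by rewrite card_configs_gt0 // card_ord.
have SP : (#|S| * 2 ^ m.-1 <= \sum_(C in configs 'I_n t) fuse_potential m (mult C))%N.
  rewrite -sum_nat_const [leqRHS](big_setID S) /= (_ : _ :&: S = S); last first.
    by apply/finset.setIidPr/fintype.subsetP => C; rewrite inE => /andP[].
  apply: leq_trans (leq_addr _ _); apply: leq_sum => C.
  by rewrite inE => /andP[_ /asboolP]; exact: fuse_potential_solvable.
have H : (n * (#|S| * 2 ^ m.-1) <= (2 ^ m * t + t ^ 2) * N)%N.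
  by apply: leq_trans (sum_fuse_potential t mn); rewrite leq_mul2l SP orbT.
have {}H : (n * (#|S| * 2 ^ m) <= 2 * ((2 ^ m * t + t ^ 2) * N))%N.
  have -> : (#|S| * 2 ^ m = 2 * (#|S| * 2 ^ m.-1))%N.
    by rewrite mulnCA -expnS prednK.
  by rewrite mulnCA leq_mul2l.
move: H; rewrite -(ler_nat R) !(natrM, natrD, natrX) => H.
have nR : 0 < n%:R :> R by rewrite ltr0n.
have NR : 0 < N%:R :> R by rewrite ltr0n.
have mR : 0 < 2 ^+ m :> R by rewrite exprn_gt0.
rewrite ler_pdivrMr // -(ler_pM2l (mulr_gt0 nR mR)).
apply: le_trans (_ : 2 * ((2 ^+ m * t%:R + t%:R ^+ 2) * N%:R) <= _).
  by apply: le_trans H; rewrite le_eqVlt; apply/orP; left; apply/eqP; ring.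
rewrite le_eqVlt; apply/orP; left; apply/eqP; field.
by rewrite !lt0r_neq0.
Qed.

Definition n_heavy (V : finType) (A : {set V}) (C : {ffun V -> nat}) : nat :=
  #|[set a in A | (2 <= C a)%N]|.

Lemma n_heavyE (V : finType) (A : {set V}) (C : {ffun V -> nat}) :
  n_heavy A C = (\sum_(a in A) (2 <= C a)%N)%N.
Proof.
rewrite /n_heavy -sum1_card big_mkcond [RHS]big_mkcond /=.
by apply: eq_bigr => a _; rewrite inE; case: (a \in A) => //; case: (2 <= C a)%N.
Qed.

Lemma sum_n_heavy (V : finType) (A : {set V}) (t : nat) :
  (\sum_(C in configs V t.+2) n_heavy A (mult C) = #|A| * #|configs V t|)%N.
Proof.
under eq_bigr do rewrite n_heavyE.
rewrite exchange_big /= -sum_nat_const; apply: eq_bigr => v _.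
exact: sum_two_pebbles.
Qed.

(** As different vertices are negatively correlated, the second moment is at
    most that of a sum of independent indicators, and a fortiori
    [mean + mean ^ 2]. *)
Lemma sum_n_heavy_sqr (V : finType) (A : {set V}) (t : nat) :
  (#|configs V t.+2| * \sum_(C in configs V t.+2) n_heavy A (mult C) ^ 2 <=
   #|A| * #|configs V t| * #|configs V t.+2| + (#|A| * #|configs V t|) ^ 2)%N.
Proof.
set N := #|configs V t.+2|; set M := #|configs V t|.
have -> : (\sum_(C in configs V t.+2) n_heavy A (mult C) ^ 2 =
    \sum_(u in A) \sum_(v in A) \sum_(C in configs V t.+2)
       (2 <= mult C u) * (2 <= mult C v))%N.
  under [RHS]eq_bigr do rewrite exchange_big.
  rewrite exchange_big; apply: eq_bigr => C _.
  rewrite -mulnn n_heavyE big_distrlr /=; apply: eq_bigr => u _.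
  by apply: eq_bigr.
have pair (u v : V) : (N * \sum_(C in configs V t.+2) (2 <= mult C u) * (2 <= mult C v)
    <= (if v == u then M * N else 0) + M ^ 2)%N.
  case: (altP (v =P u)) => [->|vu]; last by rewrite mulnC sum_two_pebbles2 // eq_sym.
  rewrite [leqRHS]addnC; apply: leq_trans (leq_addl _ _).
  rewrite mulnC leq_mul2r /M -(sum_two_pebbles u t) leq_sum ?orbT // => C _.
  by case: (2 <= _)%N.
have {}pair (u : V) : u \in A -> (N * \sum_(v in A) \sum_(C in configs V t.+2)
       (2 <= mult C u) * (2 <= mult C v) <= M * N + #|A| * M ^ 2)%N.
  move=> uA; rewrite big_distrr /=.
  apply: leq_trans (leq_sum _ (fun v _ => pair u v)) _.
  rewrite big_split /= sum_nat_const leq_add2r (bigD1 u) //= eqxx.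
  by rewrite big1 ?addn0 // => v /andP[_ /negPf ->].
rewrite big_distrr /=; apply: leq_trans (leq_sum _ pair) _.
by rewrite sum_nat_const mulnDr !mulnA expnMn -!mulnn !mulnA leqnn.
Qed.

Lemma chebyshev_below (R : realType) (T : finType) (A : {set T}) (X : T -> R) (mu : R) :
  0 < mu -> \sum_(x in A) (X x - mu) ^+ 2 <= mu * #|A|%:R ->
  #|[set x in A | X x < mu / 2]|%:R <= 4 / mu * #|A|%:R.
Proof.
move=> mu0 HX; set B := finset _.
have H : (mu / 2) ^+ 2 * #|B|%:R <= mu * #|A|%:R.
  apply: le_trans HX; rewrite mulr_natr -sumr_const.
  rewrite [leRHS](big_setID B) /= (_ : A :&: B = B); last first.
    by apply/finset.setIidPr/fintype.subsetP => C; rewrite inE => /andP[].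
  apply: ler_wpDr; first by apply: sumr_ge0 => *; exact: sqr_ge0.
  by apply: ler_sum => x; rewrite inE => /andP[_ xmu]; nra.
rewrite -(ler_pM2l (_ : 0 < (mu / 2) ^+ 2)); last by rewrite exprn_gt0 // divr_gt0.
apply: le_trans H _; rewrite le_eqVlt; apply/orP; left; apply/eqP; field.
by rewrite lt0r_neq0.
Qed.

(** The variance of the number of heavy vertices is at most its mean [mu], and
    Chebyshev's inequality applies. *)
Lemma few_heavy (R : realType) (V : finType) (A : {set V}) (t : nat) (mu : R) :
  mu = #|A|%:R * (#|configs V t|%:R / #|configs V t.+2|%:R) -> 0 < mu ->
  #|[set C in configs V t.+2 | (n_heavy A (mult C))%:R < mu / 2]|%:R <=
    4 / mu * #|configs V t.+2|%:R.
Proof.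
move=> muE mu0; apply: chebyshev_below => //.
have := sum_n_heavy A t; have := sum_n_heavy_sqr A t.
set N := #|configs V t.+2| in muE *; set M := #|configs V t| in muE *.
rewrite -(ler_nat R) => S2 /(congr1 (GRing.natmul (1 : R))) S1.
have NR : 0 < N%:R :> R.
  rewrite lt0r ler0n andbT; apply: contraTneq mu0 => N0.
  by rewrite muE N0 invr0 !mulr0 ltxx.
under eq_bigr do rewrite sqrrB.
rewrite !big_split /= sumr_const -/N sumrN.
have -> : \sum_(C in configs V t.+2) (n_heavy A (mult C))%:R * mu *+ 2 = mu * 2 * (mu * N%:R).
  under eq_bigr do rewrite -mulrnAr mulrC.
  rewrite -big_distrr /= -natr_sum S1 natrM muE; field; exact: lt0r_neq0.
under eq_bigr do rewrite -natrX.
rewrite -natr_sum -(ler_pM2l NR) -[X in _ + X]mulr_natr.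
move: S2; rewrite !(natrM, natrD, natrX) => S2.
(* The goal is now the bound on the second moment, rearranged using this identity. *)
have e : mu * N%:R = #|A|%:R * M%:R by rewrite muE; field; exact: lt0r_neq0.
move: S2; rewrite -e => S2.
nra.
Qed.

(** The probability [#|configs V t| / #|configs V t.+2|] that a given vertex
    holds two of [t + 2] pebbles is a product of two ratios
    [(t + i) / (#|V| + t + i - 1)], [i = 1, 2]; the factor 2 makes up for the
    difference between [t + 1] and [t + 2]. *)
Lemma heavy_proba_ge (V : finType) (t : nat) : (0 < #|V|)%N ->
  (t.+2 ^ 2 * #|configs V t.+2| <= 2 * (#|V| + t.+2) ^ 2 * #|configs V t|)%N.
Proof.
move=> V0; have := card_configsS t V0; have := card_configsS t.+1 V0.
move: #|configs V t| #|configs V t.+1| #|configs V t.+2| #|V| => M K N n H2 H1.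
have e : (t.+2 * t.+1 * N = (n + t.+1) * (n + t) * M)%N by nia.
apply: (@leq_trans (2 * (t.+2 * t.+1 * N))); first by nia.
by rewrite e -[leqRHS]mulnA leq_mul2l /= leq_mul2r -mulnn leq_mul ?orbT //; lia.
Qed.

(** Here [mu] is a lower bound for the mean number of heavy leaves; if it is
    at least twice the number [2 ^ m] that ensures solvability, then failure means
    a deviation of at least half of the mean. *)
Lemma solvable_prob_ge (R : realType) (m n t : nat) (mu : R) :
  (0 < m <= n)%N -> (2 <= t)%N ->
  mu = (n - m)%:R * (t%:R ^+ 2 / (2 * (n + t)%:R ^+ 2)) ->
  2 ^+ m.+1 <= mu ->
  1 - 4 / mu <= solvable_prob R (@fuse_graph m n) t.
Proof.
case: t => [|[|t]] // mn _ muE mum; have /andP[m0 mn'] := mn.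
have n0 : (0 < n)%N by exact: leq_trans mn'.
have mu0 : 0 < mu by apply: lt_le_trans mum; rewrite exprn_gt0.
pose A := [set a : 'I_n | (m <= a)%N].
have cardA : #|A| = (n - m)%N.
  rewrite -sum1_card /A (eq_bigl (fun a : 'I_n => ~~ (a < m)%N)); last first.
    by move=> a; rewrite inE leqNgt.
  have := sum1_card 'I_n; rewrite card_ord (bigID (fun a : 'I_n => (a < m)%N)) /=.
  by rewrite -(big_ord_widen n (fun=> 1%N)) // sum1_card card_ord; lia.
rewrite /solvable_prob; set S := finset _; set N := #|configs _ _|.
have N0 : (0 < N)%N by rewrite card_configs_gt0 // card_ord.
have NR : 0 < N%:R :> R by rewrite ltr0n.
have := @heavy_proba_ge 'I_n t; rewrite card_ord => /(_ n0); rewrite -/N => Hp.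
pose nu : R := #|A|%:R * (#|configs 'I_n t|%:R / N%:R).
have munu : mu <= nu.
  rewrite muE /nu cardA ler_wpM2l // ler_pdivlMr // mulrAC ler_pdivrMr; last first.
    by rewrite mulr_gt0 // exprn_gt0 // ltr0n addn_gt0 n0.
  by rewrite -!natrX -!natrM ler_nat; lia.
have nu0 : 0 < nu by exact: lt_le_trans munu.
have := few_heavy (erefl nu) nu0; rewrite -/N.
set B := finset _ => HB.
(* A configuration is solvable unless it has fewer than half of the expected heavy leaves. *)
have cov : (N <= #|S| + #|B|)%N.
  apply: leq_trans (leq_card_setU S B); apply: subset_leq_card.
  apply/fintype.subsetP => C CN; rewrite !inE; move: (CN); rewrite inE => -> /=.
  case: ltP => [|Cnu]; first by rewrite orbT.
  rewrite orbF; apply/asboolP/fuse_solvable => //.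
  have : 2 ^+ m <= (n_heavy A (mult C))%:R :> R.
    apply: le_trans Cnu; move: (le_trans mum munu); rewrite exprS; lra.
  rewrite -natrX ler_nat /n_heavy => /leq_trans; apply; apply: subset_leq_card.
  by apply/fintype.subsetP => a; rewrite !inE.
rewrite ler_pdivlMr //.
move: cov; rewrite -(ler_nat R) natrD => cov.
have HB' : 4 / nu * N%:R <= 4 / mu * N%:R.
  by rewrite ler_pM2r // ler_pM2l // lef_pV2 ?posrE.
lra.
Qed.

(** * Threshold functions *)

Local Open Scope classical_set_scope.

Lemma solvable_prob_itv (R : realType) (V : finType) (E : rel V) (t : nat) :
  0 <= solvable_prob R E t <= 1.
Proof.
rewrite /solvable_prob divr_ge0 ?ler0n //=; have [->|N0] := posnP #|configs V t|.
  by rewrite invr0 mulr0.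
rewrite ler_pdivrMr ?ltr0n // mul1r ler_nat; apply: subset_leq_card.
by apply/fintype.subsetP => C; rewrite inE => /andP[].
Qed.

Lemma negligible_wrtP (R : realType) (f g : nat -> R) :
  negligible_wrt f g <-> (\forall n \near \oo, g n != 0) /\
    forall c : R, 0 < c -> \forall n \near \oo, `|f n| <= c * `|g n|.
Proof.
split=> -[g0 H]; split => //.
  move=> c c0; move/cvgr0Pnorm_le: H => /(_ c c0) H.
  near=> n; have gn0 : g n != 0 by near: n.
  by rewrite -ler_pdivrMr ?normr_gt0 // -normf_div; near: n.
apply/cvgr0Pnorm_le => c c0; near=> n.
have gn0 : g n != 0 by near: n.
by rewrite normf_div ler_pdivrMr ?normr_gt0 //; near: n; exact: H.
Unshelve. all: by end_near. Qed.

Lemma near_natr (R : realType) (P : nat -> Prop) :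
  (\forall n \near \oo, P n) <->
  exists2 k : R, 0 < k & forall n : nat, k < n%:R -> P n.
Proof.
split=> [[N _ HN]|[k k0 HP]].
  exists N.+1%:R => // n; rewrite ltr_nat => Nn; apply: HN; exact: ltnW (ltnW Nn).
by near=> n; apply: HP; near: n; exact: nbhs_infty_gtr.
Unshelve. all: by end_near. Qed.

Lemma bigO_ofP (R : realType) (f g : nat -> R) :
  bigO_of g f <-> exists2 c : R, 0 < c & \forall n \near \oo, f n < c * g n.
Proof.
split=> [[c [k [c0 k0 H]]]|[c c0 /(near_natr R)[k k0 H]]].
  by exists c => //; apply/(near_natr R); exists k.
by exists c, k.
Qed.

Lemma bigOmega_ofP (R : realType) (f g : nat -> R) :
  bigOmega_of g f <-> exists2 c : R, 0 < c & \forall n \near \oo, f n > c * g n.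
Proof.
split=> [[c [k [c0 k0 H]]]|[c c0 /(near_natr R)[k k0 H]]].
  by exists c => //; apply/(near_natr R); exists k.
by exists c, k.
Qed.

(** A property that holds frequently at every level [k] holds along one infinite
    set [A], at levels [kappa n] that tend to infinity: choose for each [k] some
    [n >= k] at which it holds at level [k]. *)
Lemma frequently_diagonal (Q : nat -> nat -> Prop) :
  (forall k, ~ \forall n \near \oo, ~ Q k n) ->
  exists (A : set nat) (kappa : nat -> nat),
    [/\ forall N, exists2 n, (N <= n)%N & A n,
        forall n, A n -> Q (kappa n) n &
        forall k, \forall n \near \oo, A n -> (k <= kappa n)%N].
Proof.
move=> HQ.
have ex k : exists2 n, (k <= n)%N & Q k n.
  apply: contrapT => H; apply: (HQ k); exists k => // n kn Qn.
  by apply: H; exists n.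
pose f k := s2val (cid2 (ex k)).
have fk k : (k <= f k)%N by exact: s2valP (cid2 (ex k)).
have fQ k : Q k (f k) by exact: s2valP' (cid2 (ex k)).
have inv n : exists k, (exists j, n = f j) -> n = f k.
  have [[j ->]|H] := pselect (exists j, n = f j); first by exists j.
  by exists 0%N.
pose kappa n := projT1 (cid (inv n)).
have kappaP n : (exists j, n = f j) -> n = f (kappa n) by exact: projT2 (cid (inv n)).
exists [set n | exists j, n = f j], kappa; split => [N|n An|k].
- by exists (f N) => //; exists N.
- by have := fQ (kappa n); rewrite -(kappaP n An).
(* Only one index is chosen for each level, so that [kappa] leaves it eventually. *)
- elim: k => [|k IH]; first by near=> n.
  near=> n => An.
  have : (k <= kappa n)%N by move: An; near: n.
  rewrite leq_eqVlt => /predU1P[kE|//].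
  have : (f k < n)%N by near: n; exact: nbhs_infty_gt.
  by rewrite {1}(kappaP n An) kE ltnn.
Unshelve. all: by end_near. Qed.

Lemma truncnS_itv (R : realType) (x : R) :
  0 <= x -> x < (Num.truncn x).+1%:R <= x + 1.
Proof. by move=> /truncn_itv /andP[tx ->]; rewrite -natr1 lerD2r. Qed.

Lemma eventually_natr (R : realType) (A : set nat) (kappa : nat -> nat) (a : R) :
  (forall k, \forall n \near \oo, A n -> (k <= kappa n)%N) ->
  \forall n \near \oo, A n -> a <= (kappa n).+1%:R.
Proof.
move=> Akappa; near=> n => An.
apply: le_trans (_ : (Num.truncn `|a|).+1%:R <= _).
  have /andP[/ltW + _] := truncnS_itv (normr_ge0 a).
  by apply: le_trans; exact: ler_norm.
by rewrite ler_nat ltnS; move: An; near: n; exact: Akappa.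
Unshelve. all: by end_near. Qed.

(** Suppose that, for every [e], solvability has probability at most [e] below
    some multiple of [T] and at least [1 - e] above another one.  Then functions
    of the order of [T] are thresholds.  Conversely, if a threshold [t] drops
    below every multiple of [T] infinitely often, then some numbers of pebbles
    are [>> t] everywhere and yet [<< T] along an infinite set, where they
    should be solvable with probabilities both near 1 and at most 1/3.  If [t]
    exceeds every multiple of [T] infinitely often, the opposite contradiction
    arises. *)
Lemma threshold_criterion (R : realType) (G : forall n, rel 'I_n) (T : nat -> R) :
  T n @[n --> \oo] --> +oo ->
  (forall e : R, 0 < e -> exists2 c : R, 0 < c & \forall n \near \oo,
     forall t : nat, t%:R <= c * T n -> solvable_prob R (G n) t <= e) ->
  (forall e : R, 0 < e -> exists2 c : R, 0 < c & \forall n \near \oo,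
     forall t : nat, c * T n <= t%:R -> 1 - e <= solvable_prob R (G n) t) ->
  threshold_set (R := R) G = bigTheta_of T.
Proof.
move=> /cvgryPge Too low high.
have prob01 n t := solvable_prob_itv R (@G n) t.
have third0 : 0 < 1 / 3 :> R by lra.
apply/seteqP; split => t /=; last first.
  move=> [/bigO_ofP[c c0 tO] /bigOmega_ofP[d d0 tOm]].
  have t0 : \forall n \near \oo, 0 < t n.
    near=> n; apply: le_lt_trans (_ : d * T n < _); last by near: n.
    by rewrite mulr_ge0 ?(ltW d0) //; near: n.
  split; first by near=> n; apply/ltW; near: n.
  - move=> t1 /negligible_wrtP[_ t1t]; apply/cvgr0Pnorm_le => e e0.
    have [b b0 lowe] := low e e0.
    near=> n; have /andP[p0 _] := prob01 n (t1 n); rewrite ger0_norm //.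
    have lowen : forall t : nat, t%:R <= b * T n -> solvable_prob R (@G n) t <= e.
      by near: n.
    apply: lowen.
    have : `|(t1 n)%:R| <= b / c * `|t n| :> R by near: n; apply: t1t; rewrite divr_gt0.
    have tn0 : 0 < t n by near: n.
    have tn : t n < c * T n by near: n.
    rewrite ger0_norm // gtr0_norm // => /le_trans; apply.
    by rewrite -mulrA ler_pM2l // mulrC ler_pdivrMr // mulrC ltW.
  - move=> t2 /negligible_wrtP[_ tt2]; apply/cvgrPdist_le => e e0.
    have [b b0 highe] := high e e0.
    near=> n; have /andP[_ p1] := prob01 n (t2 n); rewrite ger0_norm ?subr_ge0 //.
    have highen : forall t : nat, b * T n <= t%:R -> 1 - e <= solvable_prob R (@G n) t.
      by near: n.
    rewrite lerBlDr -lerBlDl highen //.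
    have : `|t n| <= d / b * `|(t2 n)%:R| by near: n; apply: tt2; rewrite divr_gt0.
    have tn0 : 0 < t n by near: n.
    have tn : d * T n < t n by near: n.
    rewrite gtr0_norm // ger0_norm // mulrAC ler_pdivlMr // => tt.
    rewrite -(ler_pM2l d0) mulrCA mulrC; apply: le_trans tt.
    by rewrite ler_wpM2r ?ltW.
move=> [t0 thr0 thr1].
have Omega : bigOmega_of T t.
  apply/bigOmega_ofP; apply: contrapT => notOm.
  pose Q k n := [/\ 0 <= t n, 0 < T n & t n <= k.+1%:R ^- 2 * T n].
  have [|A [kappa [Afreq AQ Akappa]]] := @frequently_diagonal Q.
    move=> k H; apply: notOm; exists (k.+1%:R ^- 2); first by rewrite invr_gt0 exprn_gt0.
    near=> n; rewrite ltNge; apply/negP => tn.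
    have nQ : ~ Q k n by near: n.
    apply: nQ; split => //; first by near: n.
    apply: (@lt_le_trans _ _ 1) => //; near: n; exact: Too.
  (* On [A], where [t <= T / (kappa + 1) ^ 2], this lies between [t] and [T];
     elsewhere it is far above [t].  Rounding up makes [t2] positive, so that
     the comparison makes sense even where [t] vanishes. *)
  pose x n : R := if `[< A n >] then (kappa n).+1%:R^-1 * T n else n.+1%:R * `|t n|.
  pose t2 n := (Num.truncn (x n)).+1.
  have t2E n : x n < (t2 n)%:R <= x n + 1.
    apply: truncnS_itv; rewrite /x; case: asboolP => [/AQ[_ T0 _]|_].
      by rewrite mulr_ge0 ?ltW.
    by rewrite mulr_ge0.
  have kappa_large := fun a : R => eventually_natr a Akappa.
  have t2t : negligible_wrt t (fun n => (t2 n)%:R).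
    apply/negligible_wrtP; split; first by near=> n; rewrite pnatr_eq0.
    move=> e e0; near=> n.
    have /andP[xt _] := t2E n; rewrite [X in _ <= _ * X]ger0_norm //.
    have ne : e^-1 <= n.+1%:R by near: n; near=> n; apply: ltW;
      apply: lt_trans (_ : n%:R < _); [near: n; exact: nbhs_infty_gtr|rewrite ltr_nat].
    have ke : A n -> e^-1 <= (kappa n).+1%:R by near: n; exact: kappa_large.
    apply: le_trans (_ : e * x n <= _); last by rewrite ler_pM2l // ltW.
    rewrite /x; case: asboolP => [An|_].
      have [tn0 Tn0 tT] := AQ n An; rewrite ger0_norm //; apply: le_trans tT _.
      rewrite mulrA ler_pM2r // expr2 invfM ler_pM2r ?invr_gt0 //.
      by rewrite invf_ple ?posrE // ke.
    by rewrite mulrA ler_peMl // -ler_pdivrMl // mulr1.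
  have [c c0 lowc] := low _ third0.
  suff [N _ HN] : \forall n \near \oo, ~ A n by have [n /HN] := Afreq N.
  have /cvgrPdist_le/(_ _ third0) prob1 := thr1 t2 t2t.
  near=> n => An.
  have lowcn : forall t : nat, t%:R <= c * T n -> solvable_prob R (@G n) t <= 1 / 3.
    by near: n.
  have : `|1 - solvable_prob R (@G n) (t2 n)| <= 1 / 3 by near: n.
  have : solvable_prob R (@G n) (t2 n) <= 1 / 3.
    apply: lowcn; have /andP[_ /le_trans->] := t2E n => //.
    rewrite /x; case: asboolP => // _; have [_ Tn0 _] := AQ n An.
    have kc : (c / 2)^-1 <= (kappa n).+1%:R by move: An; near: n; exact: kappa_large.
    have Tc : 2 / c <= T n by near: n; exact: Too.
    have h1 : 1 <= c / 2 * T n.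
      by move: Tc; rewrite ler_pdivrMr //; lra.
    have h2 : (kappa n).+1%:R^-1 * T n <= c / 2 * T n.
      by rewrite ler_pM2r // invf_ple ?posrE // divr_gt0.
    by apply: le_trans (lerD h2 h1) _; lra.
  by rewrite ler_norml => + /andP[_]; lra.
split=> //; apply/bigO_ofP; apply: contrapT => notO.
have tpos : \forall n \near \oo, 0 < t n.
  have /bigOmega_ofP[d d0 tOm] := Omega.
  near=> n; apply: le_lt_trans (_ : d * T n < _); last by near: n.
  by rewrite mulr_ge0 ?(ltW d0) //; near: n.
pose Q k n := 0 < T n /\ k.+1%:R * T n <= t n.
have [|A [kappa [Afreq AQ Akappa]]] := @frequently_diagonal Q.
  move=> k H; apply: notO; exists (k.+1%:R) => //.
  near=> n; rewrite ltNge; apply/negP => tn.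
  have nQ : ~ Q k n by near: n.
  apply: nQ; split => //; apply: (@lt_le_trans _ _ 1) => //; near: n; exact: Too.
have kappa_large := fun a : R => eventually_natr a Akappa.
have [c c0 highc] := high _ third0.
(* Of the order of [T] on [A], where [t >= (kappa + 1) * T].  Comparing with
   [t] makes sense as [t] is now known to be positive eventually. *)
pose t1 n := if `[< A n >] then (Num.truncn (c * T n)).+1 else 0%N.
have t1E n : A n -> c * T n < (t1 n)%:R <= c * T n + 1.
  move=> An; rewrite /t1 asboolT //; apply: truncnS_itv.
  by have [T0 _] := AQ n An; rewrite mulr_ge0 ?ltW.
have t1t : negligible_wrt (fun n => (t1 n)%:R) t.
  apply/negligible_wrtP; split; first by near=> n; rewrite gt_eqF //; near: n.
  move=> e e0; near=> n.
  have tn0 : 0 < t n by near: n.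
  rewrite ger0_norm // gtr0_norm //.
  have [An|nA] := pselect (A n); last by rewrite /t1 asboolF // mulr_ge0 ?ltW.
  have /andP[_ /le_trans->] := t1E n An => //.
  have [T0 Tt] := AQ n An.
  have T1 : 1 <= T n by near: n; exact: Too.
  have ke : (c + 1) / e <= (kappa n).+1%:R by move: An; near: n; exact: kappa_large.
  rewrite ler_pdivrMr // in ke.
  apply: le_trans (_ : e * ((kappa n).+1%:R * T n) <= _); last by rewrite ler_pM2l.
  by move: (kappa n).+1%:R ke => k ke; nra.
suff [N _ HN] : \forall n \near \oo, ~ A n by have [n /HN] := Afreq N.
have /cvgrPdist_le/(_ _ third0) prob0 := thr0 t1 t1t.
near=> n => An.
have highcn : forall t : nat, c * T n <= t%:R -> 1 - 1 / 3 <= solvable_prob R (@G n) t.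
  by near: n.
have : `|0 - solvable_prob R (@G n) (t1 n)| <= 1 / 3 by near: n.
have : 1 - 1 / 3 <= solvable_prob R (@G n) (t1 n).
  by apply: highcn; have /andP[/ltW] := t1E n An.
by rewrite sub0r normrN ler_norml => + /andP[_]; lra.
Unshelve. all: by end_near. Qed.

(** * The threshold of fuse graphs *)

(** With [T ^ 2 = n * 2 ^ m], the bound on the probability of solvability for
    [c * T] pebbles is [2 c (T / n) + 2 c ^ 2], which is small with [c].  For at
    least [c * T] pebbles the mean number of heavy leaves is at least the smaller
    of [n / 16] and [c ^ 2 * 2 ^ m / 16].  For large [c] both exceed [2 ^ (m + 1)]
    and any given constant eventually, because [T << n] means [2 ^ m << n]. *)
Lemma fuse_threshold (R : realType) (m : nat -> nat) (T : nat -> R) :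
  (\forall n \near \oo, (0 < m n <= n)%N) ->
  (\forall n \near \oo, 0 < T n /\ T n ^+ 2 = n%:R * 2 ^+ m n) ->
  negligible_wrt T (fun n => n%:R) ->
  threshold_set (R := R) (fun n => @fuse_graph (m n) n) = bigTheta_of T.
Proof.
move=> mn TE /negligible_wrtP[_ Tn].
have pow1 n : 1 <= 2 ^+ m n :> R by rewrite exprn_ege1 // ler1n.
have n0 : \forall n \near \oo, 0 < n%:R :> R by exact: nbhs_infty_gtr.
have {}Tn (c : R) : 0 < c -> \forall n \near \oo, T n <= c * n%:R.
  move=> /Tn cT; near=> n.
  have nR : 0 < n%:R :> R by near: n.
  apply: le_trans (ler_norm _) _; rewrite -[n%:R in leRHS]gtr0_norm //.
  by near: n.
apply: threshold_criterion.
- apply/cvgryPge => M; near=> n.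
  have [T0 T2] : 0 < T n /\ T n ^+ 2 = n%:R * 2 ^+ m n by near: n.
  apply: le_trans (ler_norm M) _.
  rewrite -(ler_pXn2r (n := 2)) ?nnegrE ?(ltW T0) // T2.
  apply: le_trans (_ : n%:R <= _); first by near: n; exact: nbhs_infty_ger.
  by rewrite ler_peMr.
- move=> e e0.
  have [c [c0 c1 ce]] : exists c, [/\ 0 < c, c <= 1 & 4 * c <= e].
    exists (Num.min 1 (e / 4)); split; first by rewrite lt_min ltr01 divr_gt0.
      by rewrite ge_min lexx.
    by rewrite -ler_pdivlMl // mulrC ge_min lexx orbT.
  exists c => //; near=> n => t tc.
  have [T0 T2] : 0 < T n /\ T n ^+ 2 = n%:R * 2 ^+ m n by near: n.
  have nR : 0 < n%:R :> R by near: n.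
  have Tlen : T n <= 1 * n%:R by near: n; exact: Tn.
  have mnn : (0 < m n <= n)%N by near: n.
  apply: le_trans (solvable_prob_le R t mnn) _.
  have h1 : t%:R / n%:R <= c.
    by rewrite ler_pdivrMr //; apply: le_trans tc _; rewrite ler_pM2l // -[leRHS]mul1r.
  have h2 : t%:R ^+ 2 / (n%:R * 2 ^+ m n) <= c.
    rewrite -T2 ler_pdivrMr ?exprn_gt0 //.
    apply: le_trans (_ : (c * T n) ^+ 2 <= _).
      by rewrite ler_pXn2r ?nnegrE ?mulr_ge0 // ltW.
    by rewrite exprMn ler_pM2r ?exprn_gt0 // expr2 ger_pMr.
  lra.
- move=> e e0.
  (* Any [c] with [c >= 8] and [c * e >= 8] would do: then [c ^ 2 >= 64 / e]. *)
  pose c := 8 + 8 / e; have c8 : 8 < c by rewrite ltrDl divr_gt0.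
  have ce : 8 <= c * e by rewrite mulrDl divfK ?lt0r_neq0 // lerDr mulr_ge0 // ltW.
  exists c; first lra.
  near=> n => t ct.
  have [T0 T2] : 0 < T n /\ T n ^+ 2 = n%:R * 2 ^+ m n by near: n.
  have nR : 0 < n%:R :> R by near: n.
  have mnn : (0 < m n <= n)%N by near: n.
  have small : 32 * 2 ^+ m n <= n%:R :> R.
    have : T n <= 8^-1 * n%:R by near: n; apply: Tn; rewrite invr_gt0.
    have : T n <= 4^-1 * n%:R by near: n; apply: Tn; rewrite invr_gt0.
    move=> h1 h2; rewrite -(ler_pM2l nR) mulrCA -T2; nra.
  have half : n%:R <= 2 * (n - m n)%:R :> R.
    have mlt : (m n)%:R <= 2 ^+ m n :> R by rewrite -natrX ler_nat ltnW // ltn_expl.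
    have /andP[_ mlen] := mnn; rewrite natrB //; have := pow1 n; lra.
  have T1 : 1 <= T n.
    rewrite -(ler_pXn2r (n := 2)) ?nnegrE ?(ltW T0) // expr1n T2.
    by have := pow1 n; nra.
  have t8 : 8 <= t%:R :> R by apply: le_trans ct; nra.
  have t2 : (2 <= t)%N by rewrite -(ler_nat R); lra.
  pose mu : R := (n - m n)%:R * (t%:R ^+ 2 / (2 * (n + t)%:R ^+ 2)).
  have mu_ge (a : R) : 0 <= a -> a <= n%:R / 16 -> a * n%:R <= t%:R ^+ 2 / 16 -> a <= mu.
    have nt0 : (0 < n + t)%N by lia.
    move=> a0 an anT; rewrite /mu mulrA ler_pdivlMr ?mulr_gt0 ?exprn_gt0 ?ltr0n //.
    have tR : 0 < t%:R :> R by lra.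
    rewrite natrD; move: (n - m n)%:R n%:R t%:R half nR tR an anT => h N x half N0 x0 an anT.
    apply: le_trans (_ : N / 2 * x ^+ 2 <= _); last by rewrite ler_pM2r ?exprn_gt0 //; lra.
    (* [(N + x) ^ 2] is at most 4 times the square of the larger of [N] and [x]. *)
    have [xN|/ltW Nx] := leP x N.
      have D : (N + x) ^+ 2 <= 4 * N ^+ 2 by nra.
      apply: le_trans (_ : a * (2 * (4 * N ^+ 2)) <= _); first by rewrite ler_wpM2l // ler_pM2l.
      have -> : a * (2 * (4 * N ^+ 2)) = 8 * N * (a * N) by ring.
      have -> : N / 2 * x ^+ 2 = 8 * N * (x ^+ 2 / 16) by field.
      by rewrite ler_pM2l // mulr_gt0.
    have D : (N + x) ^+ 2 <= 4 * x ^+ 2 by nra.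
    apply: le_trans (_ : a * (2 * (4 * x ^+ 2)) <= _); first by rewrite ler_wpM2l // ler_pM2l.
    have -> : a * (2 * (4 * x ^+ 2)) = a * (8 * x ^+ 2) by ring.
    have -> : N / 2 * x ^+ 2 = N / 16 * (8 * x ^+ 2) by field.
    by rewrite ler_pM2r // mulr_gt0 // exprn_gt0.
  have nT : n%:R * 2 ^+ m n * c ^+ 2 <= t%:R ^+ 2 :> R.
    rewrite -T2 -exprMn mulrC ler_pXn2r ?nnegrE // mulr_ge0 ?(ltW T0) //; lra.
  have m2 : 2 ^+ (m n).+1 <= mu.
    have c2 : 64 <= c ^+ 2 by nra.
    rewrite exprS; apply: mu_ge; [by rewrite mulr_ge0 // exprn_ge0|lra|].
    have : n%:R * 2 ^+ m n * 64 <= n%:R * 2 ^+ m n * c ^+ 2.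
      by rewrite ler_pM2l // mulr_gt0 // exprn_gt0.
    have : 0 < n%:R * 2 ^+ m n :> R by rewrite mulr_gt0 // exprn_gt0.
    lra.
  have mue : 4 / e <= mu.
    apply: mu_ge; first by rewrite divr_ge0 // ltW.
      by rewrite ler_pdivlMr //; near: n; exact: nbhs_infty_ger.
    have c2 : 64 / e <= c ^+ 2 by rewrite ler_pdivrMr //; nra.
    have : n%:R * (64 / e) <= n%:R * 2 ^+ m n * c ^+ 2.
      rewrite -mulrA ler_pM2l //; apply: le_trans c2 _.
      by rewrite ler_peMl // sqr_ge0.
    have -> : 4 / e * n%:R = n%:R * (64 / e) / 16 by field; rewrite lt0r_neq0.
    lra.
  apply: le_trans (solvable_prob_ge mnn t2 erefl m2).
  rewrite lerD2l lerN2 ler_pdivrMr; last first.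
    by apply: lt_le_trans mue; rewrite divr_gt0.
  by rewrite mulrC -ler_pdivrMr.
Unshelve. all: by end_near. Qed.

Theorem theorem2 (R : realType) (eps : nat -> R) (m : nat -> nat)
    (eps_lt : forall n : nat, (0 < n)%N -> eps n < 1 / 2)
    (eps_negl : negligible_wrt (fun n : nat => n%:R `^ (1 - eps n))
                               (fun n : nat => n%:R))
    (m_def : \forall n \near \oo,
       (0 < m n <= n)%N /\ (m n)%:R = (1 - 2 * eps n) * lg (n%:R : R)) :
  threshold_set (fun n => @fuse_graph (m n) n) =
  bigTheta_of (fun n : nat => n%:R `^ (1 - eps n)).
Proof.
apply: fuse_threshold => //; first by apply: filterS m_def => ? -[].
near=> n.
have nR : 0 < n%:R :> R by near: n; exact: nbhs_infty_gtr.
have [_ mE] : (0 < m n <= n)%N /\ (m n)%:R = (1 - 2 * eps n) * lg (n%:R : R).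
  by near: n.
split; first exact: powR_gt0.
rewrite -[X in X ^+ m n]lnK ?posrE // -expRM_natl mE /lg -mulrA divfK; last first.
  by rewrite gt_eqF // ln_gt0 // ltr1n.
rewrite -[X in X * _](lnK (x := n%:R)) ?posrE // -expRD.
rewrite /powR gt_eqF // -expRM_natl; congr (expR _); ring.
Unshelve. all: by end_near. Qed.
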